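(* The following statements are equivalent. (a) $\mathfrak{X}$ is finite. (b) $\mathcal{M}$ has a bounded right (or left) pc-approximate unit. (c) $\mathcal{M}$ has a unit. (The equivalence holds with ''right'' in (b), and it also holds with ''left'' in (b).)
   Context: $\mathfrak{X}$ is a fixed compact metrizable space and $\mathfrak{m}$ is a fixed Borel probability measure on $\mathfrak{X}$ whose support is all of $\mathfrak{X}$. $\mathcal{M}=\mathcal{M}_{\mathfrak{X},\mathfrak{m}}$ denotes the Banach $*$-algebra $\mathbf{C}(\mathfrak{X}^2)$ of continuous complex functions on $\mathfrak{X}\times\mathfrak{X}$ with the supremum norm, the multiplication $(f\star g)(x,y)=\int_{\mathfrak{X}}f(x,z)g(z,y)\,d\mathfrak{m}(z)$ and the involution $f^*(x,y)=\overline{f(y,x)}$. The pointwise convergence topology (pct) on $\mathcal{M}$ is the vector topology in which $f_\lambda\to f$ iff $f_\lambda(x,y)\to f(x,y)$ for all $x,y\in\mathfrak{X}$. A right (resp. left) pc-approximate unit for $\mathcal{M}$ is a net $(u_\lambda)_\lambda$ in $\mathcal{M}$ such that $a\star u_\lambda\to a$ (resp. $u_\lambda\star a\to a$) in the pct for every $a\in\mathcal{M}$; it is bounded if $\sup_\lambda\|u_\lambda\|_\infty<\infty$. *)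

(* Defs.v *)
From HB Require Import structures.
From mathcomp Require Import all_boot all_order all_algebra.
From mathcomp Require Import complex.
From mathcomp Require Import all_classical all_reals all_analysis.

Set Implicit Arguments.
Unset Strict Implicit.
Unset Printing Implicit Defensive.
Import Order.TTheory GRing.Theory Num.Theory.
Import numFieldNormedType.Exports.

Local Open Scope classical_set_scope.
Local Open Scope ring_scope.
Local Open Scope complex_scope.

(* The usual topology of the complex numbers: the one given by the modulus. *)
HB.instance Definition _ (R : realType) := NormedModule.copy R[i] (R[i])^o.

Definition metrizable (R : realType) (X : topologicalType) : Prop :=
  exists d : X -> X -> R,
    [/\ forall x y, 0 <= d x y,
        forall x y, d x y = 0 <-> x = y,
        forall x y, d x y = d y x,
        forall x y z, d x z <= d x y + d y z &
        forall (x : X) (A : set X),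
          nbhs x A <-> exists2 e : R, 0 < e & [set y | d x y < e] `<=` A].

Notation borel X := (g_sigma_algebraType (@open X)).

Definition measure_support (R : realType) (X : ptopologicalType)
    (m : probability (borel X) R) : set X :=
  [set x | forall U : set X, open U -> U x -> (0 < m U)%E].

Definition Cintegral (R : realType) d (T : measurableType d)
    (m : {measure set T -> \bar R}) (h : T -> R[i]) : R[i] :=
  (\int[m]_z complex.Re (h z)) +i* (\int[m]_z complex.Im (h z)).

Notation kernels R X := (continuousType (X * X)%type R[i]).

(* The supremum is that of a nonempty bounded set of reals as soon as [X] is
   compact ([X] is pointed, hence nonempty, throughout). *)
Definition supnorm (R : realType) (X : topologicalType) (f : kernels R X) : R :=
  sup [set ComplexField.Normc.normc (f p) | p in [set: X * X]].

Definition conv_fun (R : realType) (X : ptopologicalType)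
    (m : probability (borel X) R) (f g : X * X -> R[i]) : X * X -> R[i] :=
  fun p => Cintegral m (fun z : borel X => f (p.1, z) * g (z, p.2)).

Section continuity.
Context {R : realType}.

Lemma continuous_Re : continuous (fun x : R[i] => complex.Re x : R).
Proof.
move=> x; apply: (proj2 (@cvgrPdist_lt _ _ _ (nbhs x) (nbhs_filter x) _ _)) => e e0.
have : \forall y \near x, `|x - y| < e%:C.
  by apply/nbhs_normP; exists e%:C => //=; rewrite ltcR.
apply: filterS => y xy.
by rewrite -ltcR (le_lt_trans _ xy)// -raddfB normc_ge_Re.
Qed.

Lemma continuous_Im : continuous (fun x : R[i] => complex.Im x : R).
Proof.
move=> x; apply: (proj2 (@cvgrPdist_lt _ _ _ (nbhs x) (nbhs_filter x) _ _)) => e e0.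
have : \forall y \near x, `|x - y| < e%:C.
  by apply/nbhs_normP; exists e%:C => //=; rewrite ltcR.
apply: filterS => y xy.
rewrite -ltcR (le_lt_trans _ xy)// -raddfB.
case: (x - y) => a b /=; rewrite normc_def lecR/=.
by rewrite -sqrtr_sqr ler_wsqrtr// lerDr sqr_ge0.
Qed.

Lemma continuous_Complex (T : topologicalType) (a b : T -> R) :
  continuous a -> continuous b -> continuous (fun t => a t +i* b t : R[i]).
Proof.
move=> ca cb t; apply: (proj2 (cvgrPdist_lt _ _)) => -[e e'].
rewrite ltcE/= => /andP[/eqP -> e0].
have e2 : 0 < e / 2 by rewrite divr_gt0.
have /cvgrPdist_lt/(_ _ e2) A := ca t; have /cvgrPdist_lt/(_ _ e2) B := cb t.
near=> s.
have -> : a t +i* b t - (a s +i* b s) =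
  (a t - a s)%:C + 'i * (b t - b s)%:C :> R[i] by simpc.
apply: le_lt_trans (ler_normD _ _) _.
rewrite normrM !normc_def/= expr0n/= !addr0 add0r expr1n sqrtr1 mul1r !sqrtr_sqr.
rewrite -rmorphD/= ltcR [e]splitr.
by apply: ltrD; near: s.
Unshelve. all: by end_near. Qed.

Context {X : ptopologicalType} (m : probability (borel X) R).

Lemma continuous_borel_measurable (h : X -> R) :
  continuous h -> measurable_fun [set: borel X] (h : borel X -> R).
Proof.
move=> /continuousP ch; apply: (measurability _ (measurable_realfun.RGenOpens.measurableE R)).
move=> _ [_ [a [b ->] <-]]; rewrite setTI; apply: sub_sigma_algebra.
exact/ch/interval_open.
Qed.

Hypothesis cX : compact [set: X].

Lemma continuous_integrable (h : X -> R) :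
  continuous h -> m.-integrable [set: borel X] (EFin \o (h : borel X -> R)).
Proof.
move=> ch; apply: measurable_bounded_integrable => //.
- by apply: le_lt_trans (ltry 1); exact: probability_le1.
- exact: continuous_borel_measurable.
- have /compact_bounded[M [_ HM]] : compact (h @` [set: X]).
    by apply: continuous_compact => //; exact: continuous_subspaceT.
  exists M; split; first exact: num_real.
  by move=> r Mr z _ /=; apply: HM.
Qed.

Lemma continuous_Rintegral (Y : topologicalType) (h : Y * X -> R) :
  continuous h -> continuous (fun y => \int[m]_z h (y, z)).
Proof.
move=> ch y0.
have ch1 y : continuous (fun z => h (y, z)).
  by move=> z; apply: (@cvg_comp _ _ _ (fun z => (y, z)) h _ (nbhs (y, z)));
    [apply: cvg_pair; [exact: cvg_cst|exact: cvg_id]|exact: ch].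
apply/cvgrPdist_le => e e0.
have e2 : 0 < e / 2 by rewrite divr_gt0.
have near_y0 : \forall y \near y0,
    [set: X] `<=` (fun z => `|h (y0, z) - h (y, z)| <= e).
  move/compact_near_coveringP: cX; apply => x _.
  have /cvgrPdist_lt/(_ _ e2) [[/= A B] [nA nB] AB] := ch (y0, x).
  exists (B, A) => //= -[z y] /= [Bz Ay].
  rewrite (le_trans (ler_distD (h (y0, x)) _ _))// [e]splitr lerD//; apply/ltW.
    rewrite distrC; apply: (AB (y0, z)); split => //=.
    exact: nbhs_singleton.
  by apply: (AB (y, z)).
apply: filterS near_y0 => y Hy.
rewrite -RintegralB//; try exact: continuous_integrable.
have chB : continuous (fun z => h (y0, z) - h (y, z)).
  by move=> z; apply: cvgB; exact: ch1.
apply: (le_trans (le_normr_Rintegral _ _)) => //.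
  exact: continuous_integrable.
have -> : e = \int[m]_(z in [set: borel X]) e.
  rewrite Rintegral_cst// -[LHS]mulr1; congr (_ * _).
  by rewrite -[LHS]/(fine 1%E); congr fine; apply/esym; exact: probability_setT.
apply: le_Rintegral => //.
- apply: (continuous_integrable (h := fun z => `|h (y0, z) - h (y, z)|)).
  by move=> z; apply: cvg_norm; exact: chB.
- apply: (continuous_integrable (h := fun=> e)) => z; exact: cvg_cst.
Qed.

Lemma conv_fun_continuous (f g : kernels R X) : continuous (conv_fun m f g).
Proof.
pose k (q : (X * X) * X) : R[i] := f (q.1.1, q.2) * g (q.2, q.1.2).
have c11 : continuous (fun q : (X * X) * X => q.1.1).
  by move=> q; apply: (@continuous_comp _ _ _ fst fst); exact: cvg_fst.
have c12 : continuous (fun q : (X * X) * X => q.1.2).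
  move=> q; apply: (@continuous_comp _ _ _ fst snd).
    exact: cvg_fst.
  exact: cvg_snd.
have c2 : continuous (fun q : (X * X) * X => q.2) by move=> q; exact: cvg_snd.
have ck : continuous k.
  move=> q; apply: (@continuousM _ _
      (fun q => f (q.1.1, q.2)) (fun q => g (q.2, q.1.2))).
    apply: (@continuous_comp _ _ _ (fun q : (X * X) * X => (q.1.1, q.2)) f).
      by apply: cvg_pair; [exact: c11|exact: c2].
    exact: cts_fun.
  apply: (@continuous_comp _ _ _ (fun q : (X * X) * X => (q.2, q.1.2)) g).
    by apply: cvg_pair; [exact: c2|exact: c12].
  exact: cts_fun.
apply: continuous_Complex.
- apply: (continuous_Rintegral (h := fun q => complex.Re (k q))) => q.
  by apply: continuous_comp; [exact: ck|exact: continuous_Re].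
- apply: (continuous_Rintegral (h := fun q => complex.Im (k q))) => q.
  by apply: continuous_comp; [exact: ck|exact: continuous_Im].
Qed.

Definition conv (f g : kernels R X) : kernels R X :=
  mkcts (@conv_fun_continuous f g).

End continuity.

(* A net with values in [T] is a family [u : D -> T] over a directed set. *)
Record directed_set := DirectedSet {
  index :> Type;
  precedes : index -> index -> Prop;
  precedes_refl : forall i, precedes i i;
  precedes_trans : forall i j k, precedes i j -> precedes j k -> precedes i k;
  precedes_directed :
    forall i j, exists k, precedes i k /\ precedes j k;
  index_inhabited : inhabited index }.

Definition tails (D : directed_set) : set_system D :=
  [set A | exists i, forall j, precedes i j -> A j].

Instance tails_proper_filter (D : directed_set) : ProperFilter (@tails D).
Proof.
split.
  by move=> [i /(_ i (precedes_refl i))].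
split.
- by case: (index_inhabited D) => i; exists i.
- move=> A B [i iA] [j jB]; have [k [ik jk]] := precedes_directed i j.
  exists k => l kl.
  by split; [exact/iA/(precedes_trans ik)|exact/jB/(precedes_trans jk)].
- by move=> A B AB [i iA]; exists i => j /iA /AB.
Qed.

Section approximate_units.
Context {R : realType} {X : ptopologicalType} (m : probability (borel X) R).
Hypothesis cX : compact [set: X].

(* Convergence in the subspace topology that the continuous functions inherit
   from the product topology on [X * X -> R[i]]. *)
Definition pct_cvg (D : directed_set) (f : D -> kernels R X)
    (g : kernels R X) : Prop :=
  {ptws, (fun l => f l : X * X -> R[i]) @ @tails D --> (g : X * X -> R[i])}.

Definition right_pc_approximate_unit (D : directed_set) (u : D -> kernels R X) :=
  forall a : kernels R X, pct_cvg (fun l => conv m cX a (u l)) a.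

Definition left_pc_approximate_unit (D : directed_set) (u : D -> kernels R X) :=
  forall a : kernels R X, pct_cvg (fun l => conv m cX (u l) a) a.

Definition bounded_net (D : directed_set) (u : D -> kernels R X) :=
  exists K : R, forall l, supnorm (u l) <= K.

Definition is_unit (e : kernels R X) :=
  forall a : kernels R X, conv m cX e a = a /\ conv m cX a e = a.

End approximate_units.

(* Main.v *)
Require Import Defs.
From HB Require Import structures.
From mathcomp Require Import all_boot all_order all_algebra.
From mathcomp Require Import complex.
From mathcomp Require Import all_classical all_reals all_analysis.

Set Implicit Arguments.
Unset Strict Implicit.
Unset Printing Implicit Defensive.
Import Order.TTheory GRing.Theory Num.Theory.
Import numFieldNormedType.Exports.

Local Open Scope classical_set_scope.
Local Open Scope ring_scope.
Local Open Scope complex_scope.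

(* If [X] is finite then it is discrete, points have positive mass and
   [e (x, y) = (x == y) / m {y}] is a unit; a unit is a constant bounded
   approximate unit. Conversely, testing an approximate unit bounded by [K] on
   kernels that depend on one variable only gives [f y <= K * \int f] for all
   continuous [f >= 0] and all [y]. Summed over a partition of unity peaked at
   [n] distinct points this yields [n <= K], so [X] is finite. *)

(** * Distance functions of metrizable spaces *)

Section metrizable_space.
Context {R : realType} {X : topologicalType} (d : X -> X -> R).
Hypothesis d0 : forall x y, 0 <= d x y.
Hypothesis d_eq0 : forall x y, d x y = 0 <-> x = y.
Hypothesis dC : forall x y, d x y = d y x.
Hypothesis dD : forall x y z, d x z <= d x y + d y z.
Hypothesis nbhs_d : forall (x : X) (A : set X),
  nbhs x A <-> exists2 e : R, 0 < e & [set y | d x y < e] `<=` A.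

Lemma dist_gt0 x y : x != y -> 0 < d x y.
Proof.
move=> xy; rewrite lt_neqAle d0 andbT eq_sym; apply: contra_neq xy.
by move/d_eq0.
Qed.

(** The triangle inequality makes [d ^~ y] 1-Lipschitz, so the radius [e] itself serves as the
    modulus of continuity. *)
Lemma dist_continuous y : continuous (d ^~ y).
Proof.
move=> x; apply/cvgrPdist_lt => e e0; apply/nbhs_d; exists e => // z /= xz.
rewrite (le_lt_trans _ xz)// ler_norml; apply/andP; split.
  by rewrite lerBrDr addrC lerBlDr addrC [d x z]dC dD.
by rewrite lerBlDr dD.
Qed.

Lemma metrizable_accessible : accessible_space X.
Proof.
move=> x y xy; exists [set~ y]; split; last 2 first.
- by rewrite inE; exact/eqP.
- by rewrite setCK inE.
rewrite openE => z zy; apply/nbhs_d; exists (d z y).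
  by apply: dist_gt0; exact/eqP.
by move=> w /= /[swap] ->; rewrite ltxx.
Qed.

End metrizable_space.

(** * Finite accessible spaces are discrete *)

Section finite_space.
Context {X : topologicalType}.
Hypothesis aX : accessible_space X.
Hypothesis finX : finite_set [set: X].

Lemma finite_space_open (A : set X) : open A.
Proof.
rewrite -closedC; apply: (accessible_finite_set_closed.1 aX).
exact: sub_finite_set finX.
Qed.

Lemma finite_space_continuous (Y : topologicalType) (f : X * X -> Y) :
  continuous f.
Proof.
move=> [x y] A /nbhs_singleton Af.
exists ([set x], [set y]) => /=; last by move=> [a b] [/= -> ->].
by split; apply: open_nbhs_nbhs; split => //; exact: finite_space_open.
Qed.

End finite_space.

(** * Sup norm and integral estimates for continuous kernels *)

Section kernels.
Context {R : realType} {X : ptopologicalType} (m : probability (borel X) R).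
Hypothesis cX : compact [set: X].

(** By compactness of [X * X] the set of moduli is bounded above, so [sup] really is an upper bound
    of it. *)
Lemma normc_le_supnorm (f : kernels R X) p :
  ComplexField.Normc.normc (f p) <= supnorm f.
Proof.
have cn : continuous (fun q => ComplexField.Normc.normc (f q)).
  have -> : (fun q => ComplexField.Normc.normc (f q)) =
      (fun q => complex.Re `|f q|).
    by apply/funext => q; rewrite normc_def; case: (f q).
  move=> q; apply: (@continuous_comp _ _ _ (fun q => `|f q|) (@complex.Re R)).
    by apply: cvg_norm; exact: cts_fun.
  exact: continuous_Re.
have /compact_bounded[M [_ HM]] :
    compact ((fun q => ComplexField.Normc.normc (f q)) @` [set: X * X]).
  apply: continuous_compact; first exact: continuous_subspaceT.
  by rewrite -setXTT; exact: compact_setX.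
apply: ub_le_sup; last by exists p.
(* [HM] gives a bound only for reals strictly above [M], hence [M + 1]. *)
exists (M + 1) => _ [q _ <-].
by apply: le_trans (ler_norm _) (HM _ _ _ _) => //; rewrite ltrDl.
Qed.

(** As [f] is real and nonnegative, the real part of the integrand is [f z] times the real part of
    [v z], which is at most [K * f z]. This is where boundedness of the net enters. *)
Lemma Re_Cintegral_le (f : X -> R) (v : X -> R[i]) (K : R) :
  continuous f -> continuous v -> (forall z, 0 <= f z) ->
  (forall z, ComplexField.Normc.normc (v z) <= K) ->
  complex.Re (Cintegral m (fun z : borel X => (f z)%:C * v z))
    <= K * \int[m]_z f z.
Proof.
move=> cf cv f0 vK /=.
have cRv : continuous (fun z => complex.Re (v z)).
  by move=> z; apply: continuous_comp; [exact: cv|exact: continuous_Re].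
rewrite -RintegralZl//; last exact: continuous_integrable.
apply: le_Rintegral => //.
- apply: (continuous_integrable m cX (h := fun z => complex.Re ((f z)%:C * v z))).
  have -> : (fun z => complex.Re ((f z)%:C * v z)) =
      (fun z => f z * complex.Re (v z)).
    by apply/funext => z; case: (v z) => a b /=; rewrite mul0r subr0.
  by move=> z; apply: cvgM; [exact: cf|exact: cRv].
- apply: (continuous_integrable m cX (h := fun z => K * f z)).
  by move=> z; apply: cvgM; [exact: cvg_cst|exact: cf].
move=> z _; have := vK z; case: (v z) => a b /= abK.
rewrite mul0r subr0 mulrC ler_wpM2r// (le_trans _ abK)//.
by rewrite (le_trans (ler_norm _))// -sqrtr_sqr ler_wsqrtr// lerDl sqr_ge0.
Qed.

Lemma Rintegral_sum_continuous (I : Type) (s : seq I) (h : I -> X -> R) :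
  (forall i, continuous (h i)) ->
  \int[m]_z (\sum_(i <- s) h i z) = \sum_(i <- s) \int[m]_z h i z.
Proof.
move=> ch; elim: s => [|i s IH].
  rewrite big_nil; under eq_Rintegral do rewrite big_nil.
  by rewrite Rintegral_cst// mul0r.
rewrite big_cons -IH -RintegralD//.
- by apply: eq_Rintegral => z _; rewrite big_cons.
- exact: continuous_integrable.
- apply: (continuous_integrable m cX (h := fun z => \sum_(i <- s) h i z)).
  apply: continuous_big => //; exact: add_continuous.
Qed.

End kernels.

(** * From an evaluation bound to finiteness *)

Section pc_approximate_units.
Context {R : realType} {X : ptopologicalType} (m : probability (borel X) R).
Hypothesis cX : compact [set: X].

(* With the weights [D y z := \prod_(w <- B | w != y) d z w], the functions
   [h y := D y / \sum_y D y] form a partition of unity with [h y y = 1], so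
   summing the hypothesis over [y] gives [#|B| <= K]. *)
Lemma finite_of_eval_le_integral (K : R) : metrizable R X ->
  (forall (f : X -> R) y, continuous f -> (forall z, 0 <= f z) ->
    f y <= K * \int[m]_z f z) ->
  finite_set [set: X].
Proof.
move=> [d [d0 d_eq0 dC dD nbhs_d]] HK; apply: contrapT => infX.
(* [(Num.truncn K).+1] exceeds [K] and is positive: the first contradicts the final bound on the
   size of [s], the second makes [s] nonempty. *)
have [B _ KB] := infinite_set_fset (Num.truncn K).+1 infX.
set s := finmap.enum_fset B in KB.
have us : uniq s by exact: finmap.fset_uniq.
pose D y z : R := \prod_(w <- s | w != y) d z w.
have D0 y z : 0 <= D y z by exact: prodr_ge0.
pose S z : R := \sum_(y <- s) D y z.
have D_gt0 y z : (forall w, w \in s -> w != y -> z != w) -> 0 < D y z.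
  move=> zs; rewrite /D big_seq_cond prodr_gt0// => w /andP[ws wy].
  by apply: (dist_gt0 d0 d_eq0); exact: zs.
have s0 : exists x0, x0 \in s.
  by case: s KB {us D D0 S D_gt0} => // x0 s' _; exists x0; rewrite mem_head.
(* If [z] lies in [s], the weight [D z z] omits the only factor vanishing at [z]; otherwise no
   factor vanishes and any weight is positive. *)
have S_gt0 z : 0 < S z.
  have [y ys Dy] : exists2 y, y \in s & 0 < D y z.
    have [zs|zs] := boolP (z \in s).
      by exists z => //; apply: D_gt0 => w _; rewrite eq_sym.
    case: s0 => x0 x0s; exists x0 => //; apply: D_gt0 => w ws _.
    by apply: contraNneq zs => ->.
  rewrite /S (bigD1_seq y)//= ltr_pwDl//; exact: sumr_ge0.
have cD y : continuous (D y).
  apply: continuous_big; first exact: mul_continuous.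
  by move=> w _; exact: (dist_continuous dC dD nbhs_d).
have cS : continuous S.
  by apply: continuous_big; [exact: add_continuous|move=> y _; exact: cD].
pose h y z := D y z / S z.
have ch y : continuous (h y).
  move=> z; apply: cvgM; first exact: cD.
  by apply: cvgV; [rewrite gt_eqF|exact: cS].
have h0 y z : 0 <= h y z by rewrite divr_ge0// ltW.
have h1 y : y \in s -> h y y = 1.
  move=> ys; rewrite /h (_ : S y = D y y) ?divff ?gt_eqF//.
    by apply: D_gt0 => w _; rewrite eq_sym.
  rewrite /S (bigD1_seq y)//= big1 ?addr0// => w wy.
  (* For [w != y] the product [D w y] contains the factor [d y y = 0], so only [D y y] survives in
     [S y]. *)
  suff -> : D w y = 0 by [].
  apply/eqP; rewrite prodf_seq_eq0; apply/hasP; exists y => //.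
  by rewrite eq_sym wy (d_eq0 y y).2/=.
have : \sum_(y <- s) h y y <= \sum_(y <- s) (K * \int[m]_z h y z).
  by apply: ler_sum => y _; exact: HK.
rewrite -mulr_sumr -(Rintegral_sum_continuous m cX)//.
(* The functions [h y] add up to 1 everywhere and [m] has total mass 1. *)
have -> : \int[m]_z (\sum_(y <- s) h y z) = 1.
  transitivity (\int[m]_(z in [set: borel X]) (1 : R)).
    apply: eq_Rintegral => /= z _.
    by rewrite -mulr_suml -/(S z) divff// gt_eqF.
  by rewrite Rintegral_cst// mul1r -[RHS]/(fine 1%E) -(probability_setT m).
rewrite mulr1 big_seq (eq_bigr (fun=> 1)); last by move=> y; exact: h1.
rewrite -big_seq big_const_seq count_predT iter_addr_0 => sK.
have := truncnS_gt K; rewrite ltNge => /negP; apply.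
by apply: le_trans sK; rewrite ler_nat.
Qed.

(** * Testing approximate units on kernels of one variable *)

Lemma pct_cvg_pointwise (D : directed_set) (f : D -> kernels R X) g p :
  pct_cvg f g -> (fun l => f l p) @ @tails D --> g p.
Proof.
move=> fg; apply: (cvg_comp _ (proj p) fg).
exact: (@proj_continuous _ (fun=> R[i]) p g).
Qed.

(** The real parts of the integrals all lie in a closed half-line, hence so does their limit [f y].
    The functions [v l] stand for a column of the net in the right case and a row in the left
    case. *)
Lemma eval_le_integral_of_net (D : directed_set) (v : D -> X -> R[i]) (K : R)
    (f : X -> R) (y : X) :
  continuous f -> (forall z, 0 <= f z) -> (forall l, continuous (v l)) ->
  (forall l z, ComplexField.Normc.normc (v l z) <= K) ->
  (fun l => Cintegral m (fun z : borel X => (f z)%:C * v l z)) @ @tails D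
    --> (f y)%:C ->
  f y <= K * \int[m]_z f z.
Proof.
move=> cf f0 cv vK cvgf.
have cvgRe := cvg_comp _ _ cvgf (@continuous_Re R (f y)%:C).
apply: (closed_cvg (fun r : R => r <= K * \int[m]_z f z)) cvgRe.
  exact: closed_le.
apply: nearW => l.
exact: (@Re_Cintegral_le R X m cX f (v l) K cf (cv l) f0 (vK l)).
Qed.

Lemma continuous_real_complex (T : topologicalType) (f : T -> R) :
  continuous f -> continuous (fun t => (f t)%:C).
Proof.
by move=> cf; apply: continuous_Complex => // t; exact: cvg_cst.
Qed.

(** For [a (x, z) = f z], the value of [conv m cX a (u l)] at [(y, y)] is the integral of
    [f z * u l (z, y)], and it tends to [a (y, y) = f y]. *)
Lemma finite_of_right_pc_approximate_unit (D : directed_set)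
    (u : D -> kernels R X) : metrizable R X ->
  bounded_net u -> right_pc_approximate_unit m cX u -> finite_set [set: X].
Proof.
move=> mX [K uK] uP; apply: (finite_of_eval_le_integral (K := K) mX).
move=> f y cf f0.
have ca : continuous (fun p : X * X => (f p.2)%:C).
  apply: continuous_real_complex => p.
  by apply: (@continuous_comp _ _ _ snd f); [exact: cvg_snd|exact: cf].
apply: (@eval_le_integral_of_net D (fun l z => u l (z, y))) => //.
- move=> l z; apply: (@continuous_comp _ _ _ (fun z => (z, y)) (u l)).
    by apply: cvg_pair; [exact: cvg_id|exact: cvg_cst].
  exact: cts_fun.
- by move=> l z; apply: le_trans (uK l); exact: normc_le_supnorm.
- exact: (pct_cvg_pointwise (p := (y, y)) (uP (mkcts ca))).
Qed.

(** Mirror image of the right case: the test kernel is [a (z, x) = f z], and the row [u l (y, z)]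
    replaces the column. *)
Lemma finite_of_left_pc_approximate_unit (D : directed_set)
    (u : D -> kernels R X) : metrizable R X ->
  bounded_net u -> left_pc_approximate_unit m cX u -> finite_set [set: X].
Proof.
move=> mX [K uK] uP; apply: (finite_of_eval_le_integral (K := K) mX).
move=> f y cf f0.
have ca : continuous (fun p : X * X => (f p.1)%:C).
  apply: continuous_real_complex => p.
  by apply: (@continuous_comp _ _ _ fst f); [exact: cvg_fst|exact: cf].
apply: (@eval_le_integral_of_net D (fun l z => u l (y, z))) => //.
- move=> l z; apply: (@continuous_comp _ _ _ (fun z => (y, z)) (u l)).
    by apply: cvg_pair; [exact: cvg_cst|exact: cvg_id].
  exact: cts_fun.
- by move=> l z; apply: le_trans (uK l); exact: normc_le_supnorm.
- under eq_cvg do under eq_fun do rewrite mulrC.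
  exact: (pct_cvg_pointwise (p := (y, y)) (uP (mkcts ca))).
Qed.

(** * The unit on a finite space *)

Lemma Cintegral_set1 (h : X -> R[i]) (y : X) :
  measurable ([set y] : set (borel X)) ->
  Cintegral m (fun z : borel X => if z == y then h z else 0) =
    (fine (m [set y]))%:C * h y.
Proof.
move=> my.
have int1 (k : X -> R) :
    \int[m]_z (if (z : X) == y then k z else 0) = k y * fine (m [set y]).
  (* The right-hand side is read as the integral of the constant [k y] over [[set y]], then extended
     by zero to the whole space. *)
  rewrite -Rintegral_cst// [RHS]Rintegral_mkcond; congr Rintegral; apply/funext => z.
  rewrite /patch; case: eqP => [->|zy]; first by rewrite mem_set.
  by rewrite memNset.
rewrite /Cintegral.
under eq_Rintegral do rewrite (fun_if (@complex.Re R)).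
under [X in _ +i* X]eq_Rintegral do rewrite (fun_if (@complex.Im R)).
rewrite !int1; case: (h y) => a b /=; simpc.
by rewrite ![fine _ * _]mulrC.
Qed.

Lemma finite_is_unit : metrizable R X -> measure_support m = [set: X] ->
  finite_set [set: X] -> exists e : kernels R X, is_unit m cX e.
Proof.
move=> [d [d0 d_eq0 dC dD nbhs_d]] supp_m finX.
have aX : accessible_space X := metrizable_accessible d0 d_eq0 nbhs_d.
pose e (p : X * X) : R[i] :=
  if p.1 == p.2 then ((fine (m [set p.2]))^-1)%:C else 0.
have ce : continuous e by exact: finite_space_continuous.
have o1 (y : X) : open [set y] by exact: finite_space_open.
have m1 (y : X) : measurable ([set y] : set (borel X)).
  exact: sub_sigma_algebra.
(* The open set [[set y]] has positive mass because the support is full, and finite mass because [m]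
   is a probability; so the inverse in [e] is a genuine one. *)
have m1_neq0 y : (fine (m [set y]))%:C != 0 :> R[i].
  have : measure_support m y by rewrite supp_m.
  move=> /(_ [set y] (o1 y) erefl) my0.
  rewrite -[0]/(0%:C) (inj_eq (@complexI R)) gt_eqF// fine_gt0// my0/=.
  exact: (le_lt_trans (probability_le1 m (m1 y)) (ltry 1)).
have int_set1 y (h : X -> R[i]) :
    Cintegral m (fun z : borel X => if z == y then h z else 0) =
    (fine (m [set y]))%:C * h y by exact: Cintegral_set1.
exists (mkcts ce) => a; split; apply/continuousEP => -[x y].
(* Since [e] vanishes off the diagonal, the convolution integrand lives on the single point [z = x],
   where the mass of [[set x]] cancels its inverse. *)
- transitivity (Cintegral m (fun z : borel X => if (z : X) == x
      then ((fine (m [set x]))^-1)%:C * a (z, y) else 0)).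
    congr (Cintegral m _); apply/funext => z /=; rewrite /mkcts /e /=.
    by rewrite eq_sym; case: eqP => [->//|_]; rewrite mul0r.
  by rewrite int_set1 mulrA -rmorphM/= divff ?mul1r// -(inj_eq (@complexI R)).
- transitivity (Cintegral m (fun z : borel X => if (z : X) == y
      then a (x, z) * ((fine (m [set y]))^-1)%:C else 0)).
    congr (Cintegral m _); apply/funext => z /=; rewrite /mkcts /e /=.
    by case: eqP => [->//|_]; rewrite mulr0.
  rewrite int_set1 mulrC -mulrA -rmorphM/= mulVf ?mulr1//.
  by rewrite -(inj_eq (@complexI R)).
Qed.

(** * Units as constant approximate units *)

Definition unit_directed_set : directed_set :=
  @DirectedSet unit (fun _ _ => True) (fun=> I) (fun _ _ _ _ _ => I)
    (fun _ _ => ex_intro _ tt (conj I I)) (inhabits tt).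

(** The unit law turns every term of the net into [a] itself, so a constant net remains, which
    converges in the product topology. *)
Lemma is_unit_right_pc_approximate_unit (e : kernels R X) : is_unit m cX e ->
  right_pc_approximate_unit m cX (fun _ : unit_directed_set => e).
Proof.
move=> eP a; rewrite /pct_cvg (eP a).2.
exact: (@cvg_cst (prod_topology (fun _ : X * X => R[i]))).
Qed.

Lemma is_unit_left_pc_approximate_unit (e : kernels R X) : is_unit m cX e ->
  left_pc_approximate_unit m cX (fun _ : unit_directed_set => e).
Proof.
move=> eP a; rewrite /pct_cvg (eP a).1.
exact: (@cvg_cst (prod_topology (fun _ : X * X => R[i]))).
Qed.

End pc_approximate_units.

Theorem theorem3p4 (R : realType) (X : ptopologicalType)
    (m : probability (borel X) R) (cX : compact [set: X]) :
  metrizable R X ->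
  measure_support m = [set: X] ->
  [<-> finite_set [set: X];
       exists (D : directed_set) (u : D -> kernels R X),
         bounded_net u /\ right_pc_approximate_unit m cX u;
       exists e : kernels R X, is_unit m cX e] /\
  [<-> finite_set [set: X];
       exists (D : directed_set) (u : D -> kernels R X),
         bounded_net u /\ left_pc_approximate_unit m cX u;
       exists e : kernels R X, is_unit m cX e].
Proof.
move=> mX supp_m; have unitP := finite_is_unit cX mX supp_m.
have rightP (e : kernels R X) : is_unit m cX e ->
    exists (D : directed_set) (u : D -> kernels R X),
      bounded_net u /\ right_pc_approximate_unit m cX u.
  move=> eP; exists unit_directed_set, (fun=> e).
  split; first by exists (supnorm e).
  exact: is_unit_right_pc_approximate_unit.
have leftP (e : kernels R X) : is_unit m cX e ->
    exists (D : directed_set) (u : D -> kernels R X),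
      bounded_net u /\ left_pc_approximate_unit m cX u.
  move=> eP; exists unit_directed_set, (fun=> e).
  split; first by exists (supnorm e).
  exact: is_unit_left_pc_approximate_unit.
have right_fin (D : directed_set) (u : D -> kernels R X) :=
  finite_of_right_pc_approximate_unit (m := m) (cX := cX) (u := u) mX.
have left_fin (D : directed_set) (u : D -> kernels R X) :=
  finite_of_left_pc_approximate_unit (m := m) (cX := cX) (u := u) mX.
split; tfae.
- by move=> /unitP[e /rightP].
(* The cycle is closed through finiteness: a bounded net forces [X] to be finite, which yields the
   unit; a unit is in turn a bounded net, hence forces finiteness. *)
- by move=> [D [u [bu uP]]]; exact/unitP/(right_fin D u).
- by move=> [e /rightP[D [u [bu uP]]]]; exact: (right_fin D u).
- by move=> /unitP[e /leftP].
- by move=> [D [u [bu uP]]]; exact/unitP/(left_fin D u).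
- by move=> [e /leftP[D [u [bu uP]]]]; exact: (left_fin D u).
Qed.
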